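(* Let $\lambda=(0,0,0,0,\lambda_5,\lambda_6,\lambda_7,-\lambda_7)$ be a highest weight (for $\mathfrak{e}_7$) such that $\lambda_5>0$ and $-\lambda_5-\lambda_6-2\lambda_7=0$. (1) If $\lambda_7>6$, then $\lambda$ satisfies the strict Dirac inequality for any Schmid module $s_{a,b,c}$, i.e. $\|(\lambda-s_{a,b,c})^{+}+\rho\|^2>\|\lambda+\rho\|^2$ for all $a,b,c\in\mathbb{N}_0$ with $(a,b,c)\neq(0,0,0)$. (2) If $4<\lambda_7<6$, then $\|(\lambda-s_2)^{+}+\rho\|^2<\|\lambda+\rho\|^2$, and the strict Dirac inequality $\|(\lambda-s)^{+}+\rho\|^2>\|\lambda+\rho\|^2$ holds for any Schmid module $s$ of strictly lower level than $s_2$. (3) If $\lambda_7<4$, then the basic Dirac inequality fails, i.e. $\|(\lambda-s_1)^{+}+\rho\|^2<\|\lambda+\rho\|^2$.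
   Context: Setting for $\mathfrak{e}_7$ (Hermitian case). Work in $\mathbb{R}^8$ with the standard inner product $\langle\cdot,\cdot\rangle$ and norm $\|\cdot\|$, and let $\mathbb{N}_0=\{0,1,2,\dots\}$. Let $\varepsilon_i$ be the $i$-th coordinate functional, identified with the $i$-th standard basis vector. Put $\rho=\left(0,1,2,3,4,5,-\frac{17}{2},\frac{17}{2}\right)$ and $\alpha_1=\frac12(\varepsilon_8-\varepsilon_7-\varepsilon_6-\varepsilon_5-\varepsilon_4-\varepsilon_3-\varepsilon_2+\varepsilon_1)$. The group $W_{\mathfrak{k}}$ is generated by the reflections $s_\alpha(\mu)=\mu-\frac{2\langle\mu,\alpha\rangle}{\langle\alpha,\alpha\rangle}\alpha$ for $\alpha=\varepsilon_i\pm\varepsilon_j$ ($5\ge i>j\ge1$) and $\alpha=\alpha_1$. For $\mu\in\mathbb{R}^8$, $\mu^{+}$ denotes the unique $W_{\mathfrak{k}}$-conjugate of $\mu$ that is $\mathfrak{k}$-dominant, i.e. satisfies $|\mu_1|\le\mu_2\le\mu_3\le\mu_4\le\mu_5$ and $\frac12(\mu_8-\mu_7-\mu_6-\mu_5-\mu_4-\mu_3-\mu_2+\mu_1)\ge 0$. A highest weight is a real vector $\lambda=(\lambda_1,\dots,\lambda_6,\lambda_7,-\lambda_7)$ (so $\lambda_8=-\lambda_7$) with $|\lambda_1|\le\lambda_2\le\lambda_3\le\lambda_4\le\lambda_5$, with $\lambda_i-\lambda_j\in\mathbb{Z}$ and $2\lambda_i\in\mathbb{Z}$ for $i,j\in\{1,\dots,5\}$,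 and with $\frac12(\lambda_8-\lambda_7-\lambda_6-\lambda_5-\lambda_4-\lambda_3-\lambda_2+\lambda_1)\in\mathbb{N}_0$. The basic Schmid modules are (represented by) $s_1=(0,0,0,0,0,0,-1,1)$, $s_2=(0,0,0,0,1,1,-1,1)$, $s_3=(0,0,0,0,0,2,-1,1)$. A general Schmid module is $s_{a,b,c}=a s_1+b s_2+c s_3$ with $a,b,c\in\mathbb{N}_0$, $a+b+c>0$; its level is $a+2b+3c$. The Dirac inequality for a Schmid module $s$ is $\|(\lambda-s)^{+}+\rho\|^2\ge\|\lambda+\rho\|^2$; it is called strict if $>$ holds, and it is called the basic Dirac inequality when $s=s_1$. *)

(* Defs.v *)
From mathcomp Require Import all_boot all_order all_algebra.
From mathcomp Require Import classical_sets reals.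

Set Implicit Arguments.
Unset Strict Implicit.
Unset Printing Implicit Defensive.

Import Order.TTheory GRing.Theory Num.Theory.
Local Open Scope classical_set_scope.
Local Open Scope ring_scope.

Section E7.
Variable R : realType.
Implicit Types mu nu lambda alpha s : 'rV[R]_8.

Definition vec8 (a1 a2 a3 a4 a5 a6 a7 a8 : R) : 'rV[R]_8 :=
  \row_(j < 8) [:: a1; a2; a3; a4; a5; a6; a7; a8]`_j.

(* Coordinates are numbered from 1 to 8, as in the mathematics, whereas 'I_8
   starts at 0.  Only used for 1 <= i <= 8. *)
Definition coord mu (i : nat) : R := mu ord0 (inord i.-1).
Definition eps (i : nat) : 'rV[R]_8 := delta_mx ord0 (inord i.-1).

Definition inner mu nu : R := \sum_(j < 8) mu ord0 j * nu ord0 j.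

(* The Euclidean norm; the library norm on row vectors is the sup norm. *)
Definition enorm mu : R := Num.sqrt (inner mu mu).

Definition rho : 'rV[R]_8 := vec8 0 1 2 3 4 5 (- (17 / 2)) (17 / 2).

Definition alpha1 : 'rV[R]_8 :=
  2^-1 *: (eps 8 - eps 7 - eps 6 - eps 5 - eps 4 - eps 3 - eps 2 + eps 1).

Definition refl alpha mu : 'rV[R]_8 :=
  mu - (2 * inner mu alpha / inner alpha alpha) *: alpha.

Definition k_root alpha : Prop :=
  (exists i j : nat, (1 <= j < i)%N /\ (i <= 5)%N /\
     (alpha = eps i + eps j \/ alpha = eps i - eps j))
  \/ alpha = alpha1.

(* The generators are involutions, so the group they generate is also the
   monoid they generate. *)
Inductive Wk : ('rV[R]_8 -> 'rV[R]_8) -> Prop :=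
| Wk_id : Wk idfun
| Wk_refl alpha : k_root alpha -> Wk (refl alpha)
| Wk_comp f g : Wk f -> Wk g -> Wk (f \o g).

(* The value of alpha1 at mu. *)
Definition alpha1_val mu : R :=
  2^-1 * (coord mu 8 - coord mu 7 - coord mu 6 - coord mu 5 - coord mu 4
          - coord mu 3 - coord mu 2 + coord mu 1).

Definition D5_dominant mu : Prop :=
  [/\ `|coord mu 1| <= coord mu 2, coord mu 2 <= coord mu 3,
      coord mu 3 <= coord mu 4 & coord mu 4 <= coord mu 5].

Definition k_dominant mu : Prop := D5_dominant mu /\ 0 <= alpha1_val mu.

(* mu^+ : there is exactly one k-dominant Wk-conjugate of mu, so the default
   value 0 of xget is never used and the choice is immaterial. *)
Definition dom_conj mu : 'rV[R]_8 :=
  xget 0 [set nu | (exists2 w, Wk w & nu = w mu) /\ k_dominant nu].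

Definition highest_weight lambda : Prop :=
  [/\ coord lambda 8 = - coord lambda 7,
      D5_dominant lambda,
      forall i j : nat, (1 <= i <= 5)%N -> (1 <= j <= 5)%N ->
        coord lambda i - coord lambda j \is a Num.int,
      forall i : nat, (1 <= i <= 5)%N -> 2 * coord lambda i \is a Num.int
    & alpha1_val lambda \is a Num.nat].

Definition s1 : 'rV[R]_8 := vec8 0 0 0 0 0 0 (-1) 1.
Definition s2 : 'rV[R]_8 := vec8 0 0 0 0 1 1 (-1) 1.
Definition s3 : 'rV[R]_8 := vec8 0 0 0 0 0 2 (-1) 1.

(* A Schmid module when 0 < a + b + c. *)
Definition schmid (a b c : nat) : 'rV[R]_8 :=
  a%:R *: s1 + b%:R *: s2 + c%:R *: s3.

Definition strict_dirac lambda s : Prop :=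
  enorm (dom_conj (lambda - s) + rho) ^+ 2 > enorm (lambda + rho) ^+ 2.

End E7.

Arguments rho {R}.
Arguments s1 {R}.
Arguments s2 {R}.
Arguments s3 {R}.
Arguments schmid {R} a b c.

(* The level of schmid a b c; in particular s2 = schmid 0 1 0 has level 2. *)
Definition schmid_level (a b c : nat) : nat := (a + 2 * b + 3 * c)%N.

(* Main.v *)
(** Let P be the set of the 36 positive roots of W_k = W(E6), rho_k half their
    sum and zeta = rho - rho_k, which is orthogonal to all of them.  The
    function  N(mu) = \sum_(beta in P) |<mu, beta>|  is W_k-invariant because
    W_k permutes P up to signs, and  N(mu) = 2 <mu, rho_k>  when mu is dominant.
    Hence  ||mu^+ + rho||^2 = ||mu||^2 + 2 <mu, zeta> + N(mu) + ||rho||^2  is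
    computed without determining mu^+.  The conjugate mu^+ exists because
    reflecting in a simple root negative on mu lowers by one the number of
    positive roots negative on mu.  For mu = lambda - s_{a,b,c} the resulting
    gap is explicit; bounding its absolute values below by their arguments
    gives (1), and it equals 4 lambda_7 - 16 for s_1 and 8 lambda_7 - 48 for
    s_2. *)

Require Import Defs.
From mathcomp Require Import all_boot all_order all_algebra.
From mathcomp Require Import classical_sets reals.
From mathcomp Require Import ring lra zify.

Set Implicit Arguments.
Unset Strict Implicit.
Unset Printing Implicit Defensive.

Import Order.TTheory GRing.Theory Num.Theory.
Local Open Scope ring_scope.

Local Notation coord := Defs.coord.

(** * The root system E6 in integer coordinates *)

(* Roots are stored as twice their coordinates, so that they are integral; a
   stored root a then has dot a a = 8, whence the 4 in dreflect. *)
Definition dot (a b : seq int) : int :=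
  a`_0 * b`_0 + a`_1 * b`_1 + a`_2 * b`_2 + a`_3 * b`_3
  + a`_4 * b`_4 + a`_5 * b`_5 + a`_6 * b`_6 + a`_7 * b`_7.

Definition dreflect (a b : seq int) : seq int :=
  mkseq (fun k => b`_k - (dot b a %/ 4)%Z * a`_k) 8.

Definition d5_droot (e : int) (i j : nat) : seq int :=
  mkseq (fun k => 2 * (k == i.-1)%:R + e * (2 * (k == j.-1)%:R)) 8.

Definition alpha1_droot : seq int := [:: 1; -1; -1; -1; -1; -1; -1; 1].

Definition d5_pos : seq (seq int) :=
  [seq d5_droot p.1 p.2 j | p <- [seq (e, i) | e <- [:: 1; -1], i <- iota 2 4],
                            j <- iota 1 p.2.-1].

Definition signs : seq (seq int) :=
  iter 5 (fun L => [seq x :: l | x <- [:: 1; -1], l <- L]) [:: [::]].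

(** The 20 positive roots of D5, then the 16 roots (ε8 - ε7 - ε6 ± ε1 ± ... ± ε5)/2 with an even
    number of minus signs among the first five coordinates. *)
Definition e6_pos : seq (seq int) :=
  d5_pos ++ [seq e ++ [:: -1; -1; 1]
            | e <- [seq e <- signs | foldr *%R 1 e == 1]].

Definition e6_roots : seq (seq int) :=
  e6_pos ++ [seq map -%R b | b <- e6_pos].

Definition k_droots : seq (seq int) := alpha1_droot :: d5_pos.

(** The basis of E6 in Bourbaki's order. *)
Definition simple_droots : seq (seq int) :=
  [:: alpha1_droot; d5_droot 1 2 1; d5_droot (-1) 2 1; d5_droot (-1) 3 2;
      d5_droot (-1) 4 3; d5_droot (-1) 5 4].

(* 2 (rho - rho_k) *)
Definition dzeta : seq int := [:: 0; 0; 0; 0; 0; 18; -9; 9].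

(** A finite check, settled by computation. The divisibility by 4 makes the integer quotient in
    [dreflect] exact. *)
Lemma k_droots_spec a : a \in k_droots ->
  [/\ dot a a = 8, dot dzeta a = 0,
      {in e6_roots, forall b, dot b a = 4 * (dot b a %/ 4)%Z}
    & perm_eq (map (dreflect a) e6_roots) e6_roots].
Proof.
have /allP H : all (fun a => [&& dot a a == 8, dot dzeta a == 0,
    all (fun b => dot b a == 4 * (dot b a %/ 4)%Z) e6_roots
  & perm_eq (map (dreflect a) e6_roots) e6_roots]) k_droots.
  by vm_compute.
move=> /H /and4P[/eqP -> /eqP -> /allP h ->].
by split=> // b /h /eqP.
Qed.

(** A simple reflection permutes the positive roots other than its own; the descent in
    [k_dominant_conj] rests on this. *)
Lemma simple_droots_spec a : a \in simple_droots ->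
  [/\ a \in k_droots, a \in e6_pos
    & perm_eq (map (dreflect a) (rem a e6_pos)) (rem a e6_pos)].
Proof.
have /allP H : all (fun a => [&& a \in k_droots, a \in e6_pos
    & perm_eq (map (dreflect a) (rem a e6_pos)) (rem a e6_pos)]) simple_droots.
  by vm_compute.
by move=> /H /and3P.
Qed.

Section E6.
Variable R : realType.
Implicit Types (mu nu al : 'rV[R]_8) (a b : seq int).

(** * Real vectors, inner products and reflections *)

Lemma innerE mu nu : inner mu nu =
  coord mu 1 * coord nu 1 + coord mu 2 * coord nu 2 + coord mu 3 * coord nu 3
  + coord mu 4 * coord nu 4 + coord mu 5 * coord nu 5 + coord mu 6 * coord nu 6
  + coord mu 7 * coord nu 7 + coord mu 8 * coord nu 8.
Proof.
rewrite /inner /coord !big_ord_recr big_ord0 /= add0r.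
do ![congr (_ + _)]; congr (mu _ _ * nu _ _); apply: val_inj;
  by rewrite /= ?inordK.
Qed.

Definition vec a : 'rV[R]_8 := \row_(j < 8) ((a`_j)%:~R / 2).

Lemma coord_vec a i : (i < 8)%N -> coord (vec a) i.+1 = (a`_i)%:~R / 2.
Proof. by move=> lt_i8; rewrite /coord mxE inordK. Qed.

Lemma coordD mu nu i : coord (mu + nu) i = coord mu i + coord nu i.
Proof. by rewrite /coord mxE. Qed.

Lemma coordB mu nu i : coord (mu - nu) i = coord mu i - coord nu i.
Proof. by rewrite /coord !mxE. Qed.

Lemma coordZ c mu i : coord (c *: mu) i = c * coord mu i.
Proof. by rewrite /coord mxE. Qed.

Lemma coord_vec8 (x1 x2 x3 x4 x5 x6 x7 x8 : R) i : (i < 8)%N ->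
  coord (vec8 x1 x2 x3 x4 x5 x6 x7 x8) i.+1 =
  [:: x1; x2; x3; x4; x5; x6; x7; x8]`_i.
Proof. by move=> lt_i8; rewrite /coord mxE inordK. Qed.

Lemma inner_vec mu a : inner mu (vec a) = 2^-1 * (
  coord mu 1 * (a`_0)%:~R + coord mu 2 * (a`_1)%:~R + coord mu 3 * (a`_2)%:~R
  + coord mu 4 * (a`_3)%:~R + coord mu 5 * (a`_4)%:~R + coord mu 6 * (a`_5)%:~R
  + coord mu 7 * (a`_6)%:~R + coord mu 8 * (a`_7)%:~R).
Proof. by rewrite innerE !coord_vec //; field. Qed.

Lemma inner_vecs a b : inner (vec a) (vec b) = (dot a b)%:~R / 4.
Proof. by rewrite inner_vec !coord_vec // /dot !rmorphD !rmorphM /=; field. Qed.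

Lemma innerC mu nu : inner mu nu = inner nu mu.
Proof. by rewrite !innerE; ring. Qed.

Lemma innerDl mu nu al : inner (mu + nu) al = inner mu al + inner nu al.
Proof. by rewrite !innerE !coordD; ring. Qed.

Lemma inner_refl mu nu al : inner (refl al mu) nu =
  inner mu nu - 2 * inner mu al / inner al al * inner al nu.
Proof.
by rewrite /refl (innerE (_ - _)) !coordB !coordZ !(innerE _ nu); ring.
Qed.

Lemma inner_refl_adj mu nu al : inner (refl al mu) nu = inner mu (refl al nu).
Proof.
by rewrite (innerC mu) !inner_refl (innerC al) (innerC al) (innerC nu mu); ring.
Qed.

(** Since [dot a a] is 8, the real reflection coefficient is [dot b a] over 4, an integer here. *)
Lemma vec_dreflect a b : a \in k_droots -> b \in e6_roots ->
  vec (dreflect a b) = refl (vec a) (vec b).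
Proof.
move=> /k_droots_spec[aa _ int_ab _] /int_ab.
rewrite /dreflect; set q := (dot b a %/ 4)%Z => ab.
apply/rowP=> j; rewrite !mxE nth_mkseq // !inner_vecs aa ab.
by rewrite rmorphB !rmorphM /=; field.
Qed.

Lemma mem_d5_pos e i j : e \in [:: 1; -1] -> (0 < j < i)%N -> (i <= 5)%N ->
  d5_droot e i j \in d5_pos.
Proof.
move=> e_pm /andP[j_gt0 lt_ji] le_i5; have i_gt0 := ltn_trans j_gt0 lt_ji.
apply/allpairsPdep; exists (e, i), j; split=> //.
  by apply: allpairs_f => //; rewrite mem_iota (leq_ltn_trans j_gt0).
by rewrite mem_iota j_gt0 add1n prednK.
Qed.

Lemma vec_d5_droot e i j : (0 < j < i)%N -> (i <= 5)%N ->
  vec (d5_droot e i j) = eps R i + e%:~R *: eps R j.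
Proof.
move=> /andP[j_gt0 lt_ji] le_i5.
have lt_8 k : (0 < k <= 5)%N -> (k.-1 < 8)%N.
  by case: k => // k /andP[_ /leq_trans ->].
have lt_i8 : (i.-1 < 8)%N by rewrite lt_8 // le_i5 (ltn_trans j_gt0).
have lt_j8 : (j.-1 < 8)%N by rewrite lt_8 // j_gt0 (leq_trans (ltnW lt_ji)).
apply/rowP=> k; rewrite !mxE nth_mkseq // -!val_eqE /= !inordK //.
by rewrite rmorphD !rmorphM /= !rmorph_nat; field.
Qed.

Lemma vec_alpha1 : vec alpha1_droot = alpha1 R.
Proof.
apply/rowP=> j; rewrite !mxE -!val_eqE /= !inordK //.
by case: j => -[|[|[|[|[|[|[|[|]]]]]]]] //= _; field.
Qed.

(** Carries the computed facts about [k_droots] over to the generators of [Wk]. *)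
Lemma k_rootP al : k_root al <-> exists2 a, a \in k_droots & al = vec a.
Proof.
split=> [[[i [j [lt_ji [le_i5 [] ->]]]]| ->]|[a]].
- exists (d5_droot 1 i j); last by rewrite vec_d5_droot // scale1r.
  by rewrite inE mem_d5_pos ?orbT.
- exists (d5_droot (-1) i j); last by rewrite vec_d5_droot // scaleN1r.
  by rewrite inE mem_d5_pos ?orbT.
- by exists alpha1_droot; rewrite ?vec_alpha1 ?mem_head.
rewrite inE => /predU1P[-> ->|]; first by right; rewrite vec_alpha1.
case/allpairsPdep=> -[e i] [j] [/allpairsP[[e' i'] [e_pm i_iota [-> ->]]]].
move: i_iota; rewrite !mem_iota => /andP[i_gt1 lt_i6].
have i_gt0 := ltnW i_gt1; rewrite add1n prednK // => lt_ji -> ->.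
left; exists i', j; split=> //; split; first by rewrite -ltnS.
rewrite vec_d5_droot // -1?ltnS //.
by move: e_pm; rewrite !inE => /orP[]/eqP->;
  rewrite ?scale1r ?scaleN1r; [left|right].
Qed.

(** * The invariant N and the shifted norm *)

Definition root_norm mu : R := \sum_(b <- e6_pos) `|inner mu (vec b)|.

(** Equals ‖μ^+ + ρ‖² - ‖ρ‖², see [dirac_norm_dom_conj]; [vec] halves [dzeta], so [vec dzeta] is
    ζ. *)
Definition dirac_norm mu : R :=
  inner mu mu + 2 * inner mu (vec dzeta) + root_norm mu.

Lemma inner_vecN mu b : inner mu (vec (map -%R b)) = - inner mu (vec b).
Proof.
have nthN i : (map -%R b)`_i = - b`_i.
  have [lt_ib|le_bi] := ltnP i (size b); first by rewrite (nth_map 0).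
  by rewrite !nth_default ?size_map ?oppr0.
by rewrite !inner_vec !nthN !rmorphN /=; ring.
Qed.

Lemma sum_e6_roots mu :
  \sum_(b <- e6_roots) `|inner mu (vec b)| = 2 * root_norm mu.
Proof.
rewrite big_cat big_map /= mulr_natl mulr2n; congr (_ + _).
by apply: eq_bigr => b _; rewrite inner_vecN normrN.
Qed.

(** Doubling the sum to run over all 72 roots turns a permutation up to signs into a plain
    permutation. *)
Lemma root_norm_refl mu a : a \in k_droots ->
  root_norm (refl (vec a) mu) = root_norm mu.
Proof.
move=> aK; have [_ _ _ perm_a] := k_droots_spec aK.
have two_neq0 : (2 : R) != 0 by rewrite pnatr_eq0.
apply: (mulfI two_neq0); rewrite -!sum_e6_roots.
rewrite -[RHS](perm_big _ perm_a) big_map /=.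
by apply: eq_big_seq => b bP; rewrite inner_refl_adj -vec_dreflect.
Qed.

(** The reflection is an isometry, fixes ζ because ζ is orthogonal to the root, and preserves N. *)
Lemma dirac_norm_refl mu al : k_root al ->
  dirac_norm (refl al mu) = dirac_norm mu.
Proof.
move=> /k_rootP[a aK ->]; rewrite /dirac_norm root_norm_refl //.
have [aa za _ _] := k_droots_spec aK.
congr (_ + 2 * _ + _).
  rewrite inner_refl (innerC mu (refl _ _)) (innerC (vec a) (refl _ _)).
  by rewrite !inner_refl (innerC (vec a) mu) inner_vecs aa; field.
by rewrite inner_refl (innerC (vec a) (vec dzeta)) (inner_vecs dzeta) za; ring.
Qed.

Lemma dirac_norm_Wk mu w : Wk w -> dirac_norm (w mu) = dirac_norm mu.
Proof.
move=> Ww; elim: Ww mu => //= [al al_root mu|f g _ IHf _ IHg mu].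
  exact: dirac_norm_refl.
by rewrite IHf IHg.
Qed.

(** * Dominance and positive roots *)

Lemma k_dominantP mu :
  k_dominant mu <-> {in simple_droots, forall a, 0 <= inner mu (vec a)}.
Proof.
suff -> : k_dominant mu <-> all (fun a => 0 <= inner mu (vec a)) simple_droots.
  by split=> [/allP|h]; last apply/allP.
rewrite /= !inner_vec /k_dominant /D5_dominant /alpha1_val ler_norml /=.
split=> [[[/andP[? ?] ? ? ?] ?]|/and4P[? ? ? /and4P[? ? ? _]]].
  by do ![apply/andP; split]; lra.
by split; [split; [apply/andP; split| | |]|]; lra.
Qed.

(* The quantities are, up to a factor 1, 2 or 4, the coefficients of b on the
   simple roots, see inner_simple_coef. *)
Lemma e6_pos_coef_ge0 b : b \in e6_pos ->
  [/\ b`_5 = - b`_7, b`_6 = - b`_7, 0 <= b`_7 & 0 <= b`_4 + b`_7] /\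
  [/\ 0 <= b`_3 + b`_4 + 2 * b`_7, 0 <= b`_2 + b`_3 + b`_4 + 3 * b`_7,
      0 <= b`_0 + b`_1 + b`_2 + b`_3 + b`_4 + 3 * b`_7
    & 0 <= - b`_0 + b`_1 + b`_2 + b`_3 + b`_4 + 5 * b`_7].
Proof.
have /allP H : all (fun b =>
  [&& b`_5 == - b`_7, b`_6 == - b`_7, 0 <= b`_7 & 0 <= b`_4 + b`_7] &&
  [&& 0 <= b`_3 + b`_4 + 2 * b`_7, 0 <= b`_2 + b`_3 + b`_4 + 3 * b`_7,
      0 <= b`_0 + b`_1 + b`_2 + b`_3 + b`_4 + 3 * b`_7
    & 0 <= - b`_0 + b`_1 + b`_2 + b`_3 + b`_4 + 5 * b`_7]) e6_pos by vm_compute.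
by move=> /H /andP[/and4P[/eqP -> /eqP -> -> ->] /and4P[-> -> -> ->]].
Qed.

(** The two hypotheses place b in the six-dimensional span of the simple roots; this is its
    expansion there. *)
Lemma inner_simple_coef mu b : b`_5 = - b`_7 -> b`_6 = - b`_7 ->
  inner mu (vec b) =
    (b`_7)%:~R * inner mu (vec alpha1_droot)
  + (b`_4 + b`_7)%:~R / 2 * inner mu (vec (d5_droot (-1) 5 4))
  + (b`_3 + b`_4 + 2 * b`_7)%:~R / 2 * inner mu (vec (d5_droot (-1) 4 3))
  + (b`_2 + b`_3 + b`_4 + 3 * b`_7)%:~R / 2 * inner mu (vec (d5_droot (-1) 3 2))
  + (b`_0 + b`_1 + b`_2 + b`_3 + b`_4 + 3 * b`_7)%:~R / 4
      * inner mu (vec (d5_droot 1 2 1))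
  + (- b`_0 + b`_1 + b`_2 + b`_3 + b`_4 + 5 * b`_7)%:~R / 4
      * inner mu (vec (d5_droot (-1) 2 1)).
Proof.
move=> b5 b6; rewrite !inner_vec b5 b6 /=.
by rewrite !(rmorphN, rmorphD, rmorphM) /=; field.
Qed.

Lemma k_dominant_e6_pos mu b : k_dominant mu -> b \in e6_pos ->
  0 <= inner mu (vec b).
Proof.
move=> /k_dominantP mu_ge0 /e6_pos_coef_ge0[[b5 b6 ? ?] [? ? ? ?]].
rewrite inner_simple_coef //.
by do 5?apply: addr_ge0; apply: mulr_ge0;
  rewrite ?mulr_ge0 ?ler0z ?invr_ge0 ?mu_ge0.
Qed.

Lemma sum_e6_pos mu :
  \sum_(b <- e6_pos) inner mu (vec b) =
  2 * (inner mu rho - inner mu (vec dzeta)).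
Proof.
have sumI i : \sum_(b <- e6_pos) ((b`_i)%:~R : R) =
    (foldr +%R 0 [seq b`_i | b <- e6_pos])%:~R.
  by rewrite foldrE big_map rmorph_sum.
have sumE i k : foldr +%R 0 [seq b`_i | b <- e6_pos] = k ->
    \sum_(b <- e6_pos) coord mu i.+1 * ((b`_i)%:~R : R) = coord mu i.+1 * k%:~R.
  by move=> <-; rewrite -sumI mulr_sumr.
under eq_bigr do rewrite inner_vec.
rewrite -mulr_sumr !big_split /=.
(* The stored roots are doubled, so these constants are the coordinates of 4 ρ_k, where ρ_k = (0, 1,
   2, 3, 4, -4, -4, 4). *)
rewrite (sumE 0 0) // (sumE 1 4) // (sumE 2 8) // (sumE 3 12) // (sumE 4 16) //.
rewrite (sumE 5 (-16)) // (sumE 6 (-16)) // (sumE 7 16) //.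
by rewrite inner_vec innerE !coord_vec8 //=; field.
Qed.

(** For dominant μ the absolute values in N drop, and N(μ) + 2⟨μ, ζ⟩ becomes 2⟨μ, ρ⟩. *)
Lemma dirac_normE mu : k_dominant mu ->
  enorm (mu + rho) ^+ 2 = dirac_norm mu + inner (rho : 'rV[R]_8) rho.
Proof.
move=> mu_dom; rewrite /enorm sqr_sqrtr; last first.
  by apply: sumr_ge0 => j _; rewrite -expr2 sqr_ge0.
have -> : dirac_norm mu = inner mu mu + 2 * inner mu rho.
  rewrite /dirac_norm -addrA; congr (_ + _).
  have -> : root_norm mu = \sum_(b <- e6_pos) inner mu (vec b).
    by apply: eq_big_seq => b bP; rewrite ger0_norm // k_dominant_e6_pos.
  by rewrite sum_e6_pos; ring.
by rewrite !innerDl !(innerC _ (mu + _)) !innerDl (innerC rho mu); ring.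
Qed.

(** * The dominant conjugate *)

Lemma k_dominant_conj mu : exists2 w, Wk w & k_dominant (w mu).
Proof.
have [n] := ubnP (count (fun b => inner mu (vec b) < 0) e6_pos).
elim: n mu => // n IHn mu /ltnSE le_n.
have [/allP mu_dom|/allPn[a aS]] :=
    boolP (all (fun a => 0 <= inner mu (vec a)) simple_droots).
  by exists idfun; [exact: Wk_id|exact/k_dominantP].
rewrite -ltNge => a_lt0.
have [aK aP perm_a] := simple_droots_spec aS.
have [aa _ _ _] := k_droots_spec aK.
have k_a : k_root (vec a) by apply/k_rootP; exists a.
have [|w Ww w_dom] := IHn (refl (vec a) mu); last first.
  by exists (w \o refl (vec a)) => //; apply: Wk_comp => //; exact: Wk_refl.
(* The root a is counted apart: its own value changes sign under the reflection, while the other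
   positive roots are only permuted. *)
have count_rem (p : pred (seq int)) :
    count p e6_pos = (p a + count p (rem a e6_pos))%N.
  by rewrite (permP (perm_to_rem aP)).
apply: leq_trans le_n; rewrite !count_rem a_lt0 add1n ltnS.
have -> : inner (refl (vec a) mu) (vec a) < 0 = false.
  rewrite inner_refl !inner_vecs aa; lra.
rewrite add0n; apply: eq_leq; rewrite -[RHS](permP perm_a) count_map.
apply: eq_in_count => b /mem_rem bP /=.
by rewrite inner_refl_adj -vec_dreflect // /e6_roots mem_cat bP.
Qed.

(** Any conjugate returned by [xget] has the same [dirac_norm] as μ; existence rules out the default
    value. *)
Lemma dirac_norm_dom_conj mu :
  enorm (dom_conj mu + rho) ^+ 2 = dirac_norm mu + inner (rho : 'rV[R]_8) rho.
Proof.
rewrite /dom_conj; case: xgetP => [nu -> [[w Ww ->] w_dom]|no_conj].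
  by rewrite dirac_normE // dirac_norm_Wk.
have [w Ww w_dom] := k_dominant_conj mu.
by case: (no_conj (w mu)); split=> //; exists w.
Qed.

(** * Explicit evaluation on weights with four leading zeros *)

Lemma root_norm_vec8 (y p q r : R) :
  root_norm (vec8 0 0 0 0 y p q r) =
  8 * `|y| + 4 * `|y + (r - q - p)| + 4 * `|y - (r - q - p)|.
Proof.
pose F (v : seq int) := `|2^-1 * (y * (v`_0)%:~R + p * (v`_1)%:~R
                                  + q * (v`_2)%:~R + r * (v`_3)%:~R)|.
have -> : root_norm (vec8 0 0 0 0 y p q r) =
    \sum_(v <- map (drop 4) e6_pos) F v.
  rewrite big_map; apply: eq_bigr => b _.
  by rewrite inner_vec !coord_vec8 //= /F !nth_drop !mul0r !add0r.
(* Only the last four coordinates matter: 12 roots of D4 vanish there, 8 are ε5 ± ε_j, and the 16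
   half-integral roots split evenly by the sign of ε5. *)
have drop_pos : perm_eq (map (drop 4) e6_pos)
    (nseq 12 [:: 0; 0; 0; 0] ++ nseq 8 [:: 2; 0; 0; 0]
     ++ nseq 8 [:: 1; -1; -1; 1] ++ nseq 8 [:: -1; -1; -1; 1]) by vm_compute.
rewrite (perm_big _ drop_pos) !big_cat !big_nseq !iter_addr_0 /F /=.
have -> : 2^-1 * (y * 0%:~R + p * 0%:~R + q * 0%:~R + r * 0%:~R) = 0 :> R
  by ring.
have -> : 2^-1 * (y * 2%:~R + p * 0%:~R + q * 0%:~R + r * 0%:~R) = y :> R
  by field.
have -> : 2^-1 * (y * 1%:~R + p * (-1)%:~R + q * (-1)%:~R + r * 1%:~R)
    = 2^-1 * (y + (r - q - p)) :> R by ring.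
have -> : 2^-1 * (y * (-1)%:~R + p * (-1)%:~R + q * (-1)%:~R + r * 1%:~R)
    = - (2^-1 * (y - (r - q - p))) :> R by ring.
by rewrite normr0 normrN !normrM gtr0_norm ?invr_gt0 //; field.
Qed.

Lemma dirac_norm_vec8 (y p q : R) : dirac_norm (vec8 0 0 0 0 y p q (- q)) =
  y ^+ 2 + p ^+ 2 + 2 * q ^+ 2 + 18 * (p - q)
  + 8 * `|y| + 4 * `|y - (2 * q + p)| + 4 * `|y + (2 * q + p)|.
Proof.
rewrite /dirac_norm root_norm_vec8 innerE inner_vec !coord_vec8 //=.
have -> : - q - q - p = - (2 * q + p) by ring.
by rewrite opprK; field.
Qed.

Lemma vec8_sub_schmid (y p q : R) (a b c : nat) :
  vec8 0 0 0 0 y p q (- q) - schmid a b c =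
  vec8 0 0 0 0 (y - b%:R) (p - b%:R - 2 * c%:R) (q + (a + b + c)%N%:R)
    (- (q + (a + b + c)%N%:R)).
Proof.
apply/rowP=> j; rewrite !mxE !natrD.
by case: j => -[|[|[|[|[|[|[|[|]]]]]]]] //= _; ring.
Qed.

(** The linear relation says that λ is orthogonal to α1, hence to all eight half-integral positive
    roots with -ε5/2. On these roots λ - s depends on a alone, whence the term in |2a|. *)
Lemma dirac_gap_schmid (l5 l6 l7 : R) (a b c : nat)
    (lambda := vec8 0 0 0 0 l5 l6 l7 (- l7)) :
  highest_weight lambda -> 0 < l5 -> - l5 - l6 - 2 * l7 = 0 ->
  enorm (dom_conj (lambda - schmid a b c) + rho) ^+ 2
    - enorm (lambda + rho) ^+ 2
  = 4 * c%:R * l5 + (4 * l7 - 18) * (a + 2 * b + 3 * c)%N%:R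
    + b%:R ^+ 2 + (b%:R + 2 * c%:R) ^+ 2 + 2 * (a + b + c)%N%:R ^+ 2
    + 8 * (`|l5 - b%:R| - l5)
    + 4 * (`|2 * l5 - 2 * a%:R - 2 * b%:R| + `|2 * a%:R| - 2 * l5).
Proof.
move=> [_ lam_D5 _ _ lam_a1] l5_gt0 hsum.
have lam_dom : k_dominant lambda by split=> //; exact: natr_ge0.
have l6E : l6 = - l5 - 2 * l7 by lra.
rewrite dirac_norm_dom_conj (dirac_normE lam_dom).
rewrite vec8_sub_schmid !dirac_norm_vec8.
rewrite !natrD l6E.
have -> : l5 - b%:R - (2 * (l7 + (a%:R + b%:R + c%:R))
                        + (- l5 - 2 * l7 - b%:R - 2 * c%:R))
  = 2 * l5 - 2 * a%:R - 2 * b%:R by ring.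
have -> : l5 - b%:R + (2 * (l7 + (a%:R + b%:R + c%:R))
                        + (- l5 - 2 * l7 - b%:R - 2 * c%:R))
  = 2 * a%:R by ring.
have -> : l5 - (2 * l7 + (- l5 - 2 * l7)) = 2 * l5 by ring.
have -> : l5 + (2 * l7 + (- l5 - 2 * l7)) = 0 by ring.
rewrite (gtr0_norm l5_gt0) (@gtr0_norm _ (2 * l5)) ?mulr_gt0 // normr0.
by ring.
Qed.

End E6.

Theorem theorem2p10 (R : realType) (l5 l6 l7 : R)
    (lambda := vec8 0 0 0 0 l5 l6 l7 (- l7))
    (hw : highest_weight lambda) (l5_gt0 : 0 < l5)
    (hsum : - l5 - l6 - 2 * l7 = 0) :
  [/\ 6 < l7 -> forall a b c : nat, (a, b, c) <> (0, 0, 0)%N ->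
        strict_dirac lambda (schmid a b c),
      4 < l7 < 6 ->
        enorm (dom_conj (lambda - s2) + rho) ^+ 2 < enorm (lambda + rho) ^+ 2
        /\ forall a b c : nat, (0 < a + b + c)%N ->
             (schmid_level a b c < schmid_level 0 1 0)%N ->
             strict_dirac lambda (schmid a b c)
    & l7 < 4 ->
        enorm (dom_conj (lambda - s1) + rho) ^+ 2 < enorm (lambda + rho) ^+ 2].
Proof.
have gap a b c := dirac_gap_schmid a b c hw l5_gt0 hsum.
(* As λ1 = 0, integrality of λ5 - λ1 makes λ5 a positive integer. This fixes the signs inside the
   absolute values for s_1 and s_2. *)
have l5_ge1 : 1 <= l5.
  have [_ _ /(_ 5 1 isT isT) int_l5 _ _] := hw.
  move: int_l5; rewrite /lambda !coord_vec8 //= subr0 => /intrP[m l5E].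
  by move: l5_gt0; rewrite l5E ltr0z ler1z gtz0_ge1.
have gap_s1 : enorm (dom_conj (lambda - schmid 1 0 0) + rho) ^+ 2
    - enorm (lambda + rho) ^+ 2 = 4 * l7 - 16.
  by rewrite gap !ger0_norm /=; lra.
split.
- move=> l7_gt6 a b c abc_neq0; rewrite /strict_dirac -subr_gt0 gap.
  (* Writing 4 λ7 - 18 as 4 (λ7 - 6) + 6 isolates a positive multiple of the level. *)
  have lev_gt0 : 0 < (a + 2 * b + 3 * c)%N%:R * (l7 - 6).
    rewrite mulr_gt0 ?subr_gt0 // ltr0n lt0n.
    by apply/eqP => lev0; apply: abc_neq0; congr (_, _, _); lia.
  (* The absolute values cost at most 16b, of which the level term 6(a + 2b + 3c) repays 12b; the
     remaining -4b is absorbed by 4b². *)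
  have b_sqr : b%:R <= b%:R ^+ 2 :> R by rewrite -natrX ler_nat; nia.
  have absy := ler_norm (l5 - b%:R).
  have absz := ler_norm (2 * l5 - 2 * a%:R - 2 * b%:R).
  have absa := ler_norm (2 * a%:R : R).
  move: lev_gt0; rewrite !natrD.
  have c_l5 : 0 <= c%:R * l5 by rewrite mulr_ge0 // ltW.
  have [a_ge0 b_ge0 c_ge0] :
      [/\ 0 <= a%:R :> R, 0 <= b%:R :> R & 0 <= c%:R :> R].
    by rewrite !ler0n.
  have ab := mulr_ge0 a_ge0 b_ge0; have ac := mulr_ge0 a_ge0 c_ge0.
  have bc := mulr_ge0 b_ge0 c_ge0.
  have aa := mulr_ge0 a_ge0 a_ge0; have cc := mulr_ge0 c_ge0 c_ge0.
  lra.
- case/andP=> l7_gt4 l7_lt6; split.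
    have -> : s2 = schmid 0 1 0 :> 'rV[R]_8.
      by rewrite /schmid !scale0r scale1r add0r addr0.
    rewrite -subr_lt0 gap !ger0_norm /=; lra.
  move=> a b c abc_gt0 lev_lt2.
  (* Since s_2 has level 2, only s_1 lies strictly below it. *)
  have [-> -> ->] : [/\ a = 1, b = 0 & c = 0]%N.
    by move: lev_lt2; rewrite /schmid_level; split; lia.
  by rewrite /strict_dirac -subr_gt0 gap_s1; lra.
- move=> l7_lt4.
  have -> : s1 = schmid 1 0 0 :> 'rV[R]_8.
    by rewrite /schmid !scale0r scale1r !addr0.
  by rewrite -subr_lt0 gap_s1; lra.
Qed.
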